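(* Let $N,j_1,j_2,t_1,t_2\in\mathbb{N}$ be such that $j_1<N-t_1<N-t_2$ and $j_1<j_2<N-t_2$, and let $$S^{\nearrow}(N)=\{\sigma\in S_N(312):\sigma_{N-t_1}=j_1,\ \sigma_{N-t_2}=j_2\}.$$ (a) If $j_2<N-t_1+1$, then $|S^{\nearrow}(N)|=0$. (b) If $j_2\ge N-t_1+1$, then $$\begin{aligned}\left|S^{\nearrow}(N)\right|=&\sum_{i_1=\max\{1,\,j_1-j_2+N-t_1+1\}}^{j_1}\ \sum_{i_2=\max\{N-t_1+1,\,j_2-t_2\}}^{j_2}C_{N-t_1-i_1}\,C_{N-t_2-i_2}\\ &\times\frac{(j_1-i_1+1)(j_2-i_2+1)}{j_1(t_2+1)}\binom{j_1+i_1-2}{j_1-1}\binom{i_2+2t_2-j_2}{t_2}\\ &\times\left(\binom{i_1+i_2+j_2-j_1-2(N-t_1+1)}{j_2+(i_1-j_1-1)-(N-t_1)}-\binom{i_1+i_2+j_2-j_1-2(N-t_1+1)}{j_2-(N-t_1)}\right).\end{aligned}$$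
   Context: $\mathbb{N}$ denotes the positive integers. $S_N(312)$ is the set of permutations $\sigma=\sigma_1\ldots\sigma_N$ of $1,\dots,N$ for which there are no indices $i_1<i_2<i_3$ with $\sigma_{i_1}>\sigma_{i_3}>\sigma_{i_2}$. $C_n=\frac{1}{n+1}\binom{2n}{n}$ for $n\ge0$ is the Catalan number. For an integer $n\ge 0$, $\binom{n}{m}=0$ when $m<0$ or $m>n$. *)

(* Defs.v *)
From mathcomp Require Import all_boot all_order all_fingroup all_algebra.
Set Implicit Arguments.
Unset Strict Implicit.
Unset Printing Implicit Defensive.
Import GRing.Theory Num.Theory.
Local Open Scope ring_scope.

(* A permutation of {1, ..., N} is encoded as s : 'S_N acting on {0, ..., N-1};
   its one-line notation lists the values shifted by one. *)
Definition one_line (N : nat) (s : 'S_N) : seq nat :=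
  [seq (s i).+1 | i <- enum 'I_N].

(* Positions start at 1. *)
Definition letter (N : nat) (s : 'S_N) (p : nat) : nat :=
  nth 0%N (one_line s) p.-1.

Definition avoids312 (N : nat) (s : 'S_N) : bool :=
  [forall i1 : 'I_N, forall i2 : 'I_N, forall i3 : 'I_N,
     ~~ [&& (i1 < i2)%N, (i2 < i3)%N, (s i3 < s i1)%N & (s i2 < s i3)%N]].

Definition Sne (N j1 j2 t1 t2 : nat) : {set 'S_N} :=
  [set s : 'S_N | [&& avoids312 s, letter s (N - t1) == j1
                    & letter s (N - t2) == j2]].

Definition catalan (n : nat) : rat := 'C(2 * n, n)%:R / n.+1%:R.

(* Binomial coefficient with integer arguments, 0 unless 0 <= m <= n. *)
Definition binz (n m : int) : rat :=
  if (0 <= m) && (m <= n) then 'C(`|n|, `|m|)%:R else 0.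

(* Main.v *)
Require Import Defs.
From mathcomp Require Import all_boot all_order all_fingroup all_algebra.
From mathcomp Require Import zify ring.
Import GRing.Theory Num.Theory.

(** Push 1, ..., N in this order through a stack, popping at will.  The
sequences of popped values are exactly the permutations avoiding 312, and each
of them comes from a single sequence of pushes and pops: before printing a
value x above the current maximum m, the values m+1, ..., x must be pushed and
nothing more, and before printing any other value nothing may be pushed.
Reading a push as an up step and a pop as a down step gives a Dyck path of
semilength N.  This is [card_avoids312].

Write a = N - t1 and b = N - t2.  The pop number a prints j1 exactly when it
undoes the push number j1, i.e. when the path is w1 U w2 D w3 where w1 has
j1 - 1 up steps, w2 is a Dyck path and w1, w2 have a - 1 down steps together.
Let i1 - 1 be the number of down steps of w1; then w2 has semilength a - i1,
and j1 + a - i1 values have been pushed once j1 is printed.  Since j2 > j1 is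
printed after j1, it can neither lie under j1 in the stack nor be pushed above
it, so it is pushed after j1 is printed: j2 > j1 + a - i1, and as i1 <= j1
this forces j2 > a, which is part (a).  The push of j2 and the pop number b
therefore cut w3 in the same manner, i2 - 1 being the number of down steps of
the whole path before j2 is pushed.  So the path is cut into five independent
pieces ([two_letters_arch], [count_two_arches]): a path from height 0 to
height j1 - i1, a Dyck path of semilength a - i1, a path from height j1 - i1
to height j2 - i2, a Dyck path of semilength b - i2, and a path from height
j2 - i2 down to 0.  All of them stay nonnegative, and the reflection principle
[nb_pathsE] counts each piece: this gives a difference of two binomial
coefficients, which reduces to a ballot number when the path starts or ends at
height 0.  The bounds on i1 and i2 say that the heights and the numbers of
steps are nonnegative.  *)

Set Implicit Arguments.
Unset Strict Implicit.
Unset Printing Implicit Defensive.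
Local Open Scope nat_scope.

(** * Stack words *)

(* A word is a sequence of stack operations: true pushes, false pops.  As a
   lattice path, true is an up step and false a down step.  *)
Notation pushes := (count id).
Notation pops := (count negb).

(** [h] is the size of the initial stack, that is the initial height of the path. *)
Fixpoint feasible (h : nat) (w : seq bool) : bool :=
  match w with
  | [::] => true
  | true :: w' => feasible h.+1 w'
  | false :: w' => (0 < h) && feasible h.-1 w'
  end.

(** Dyck words of semilength [k]. *)
Definition balanced (k : nat) (w : seq bool) : bool :=
  [&& feasible 0 w, pushes w == k & pops w == k].

(** The input is m+1, m+2, ..., so that [m] is both the last value pushed and the
number of pushes made so far; the head of [st] is the top of the stack. *)
Fixpoint output (st : seq nat) (m : nat) (w : seq bool) : seq nat :=
  match w with
  | [::] => [::]
  | true :: w' => output (m.+1 :: st) m.+1 w'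
  | false :: w' => head 0 st :: output (behead st) m w'
  end.

Fixpoint stack_after (st : seq nat) (m : nat) (w : seq bool) : seq nat :=
  match w with
  | [::] => st
  | true :: w' => stack_after (m.+1 :: st) m.+1 w'
  | false :: w' => stack_after (behead st) m w'
  end.

(** Here [m] is the largest value already printed, hence the last one pushed:
printing [x] requires [x - m] pushes, truncated to none when [x] is already in
the stack. *)
Fixpoint code (m : nat) (s : seq nat) : seq bool :=
  if s is x :: s' then nseq (x - m) true ++ false :: code (maxn m x) s'
  else [::].

(** The first entry is tested as the 3 of the pattern, in keeping with [code], which
also treats the first entry first.  *)
Fixpoint avoid (s : seq nat) : bool :=
  if s is x :: s' then pairwise (fun y z => ~~ (y < z < x)) s' && avoid s'
  else true.

Lemma pushes_pops w : pushes w + pops w = size w.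
Proof. exact: count_predC. Qed.

Lemma feasible_pops h w : feasible h w -> pops w <= h + pushes w.
Proof.
elim: w h => [|[] w IH] h //=; first by move/IH; lia.
by case/andP=> h0 /IH; lia.
Qed.

Lemma feasible_cat h u v :
  feasible h (u ++ v) = feasible h u && feasible (h + pushes u - pops u) v.
Proof.
elim: u h => [|[] u IH] h /=; first by rewrite addn0 subn0.
  by rewrite IH; congr (_ && feasible _ _); lia.
rewrite IH; case: h => [|h] //=; congr (_ && feasible _ _); lia.
Qed.

Lemma feasible_addn h h' w : feasible h w -> feasible (h + h') w.
Proof.
elim: w h => [|[] w IH] h //=; first by move/IH; rewrite addSn.
by case: h => [|h] //= /IH.
Qed.

Lemma feasible_nseq h k w : feasible h (nseq k true ++ w) = feasible (h + k) w.
Proof. by elim: k h => [|k IH] h /=; rewrite ?addn0 // IH addSnnS. Qed.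

Lemma size_output st m w : size (output st m w) = pops w.
Proof. by elim: w st m => [|[] w IH] st m //=; rewrite IH. Qed.

Lemma output_cat st m u v :
  output st m (u ++ v) =
  output st m u ++ output (stack_after st m u) (m + pushes u) v.
Proof.
elim: u st m => [|[] u IH] st m /=; first by rewrite addn0.
  by rewrite IH addnS addSn.
by rewrite IH.
Qed.

Lemma size_stack_after st m w : feasible (size st) w ->
  size (stack_after st m w) = size st + pushes w - pops w.
Proof.
elim: w st m => [|[] w IH] st m /=; first by rewrite addn0 subn0.
  by move=> f_w; rewrite (IH (m.+1 :: st) m.+1 f_w) /=; lia.
by case: st => [|x st] //= f_w; rewrite (IH st m f_w); lia.
Qed.

Lemma stack_after_leq st m w : all (geq m) st ->
  all (geq (m + pushes w)) (stack_after st m w).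
Proof.
elim: w st m => [|[] w IH] st m le_st /=; first by rewrite addn0.
  rewrite add1n addnS -addSn; apply: IH => /=; rewrite leqnn /=.
  by apply: sub_all le_st => x /= /leqW.
by rewrite add0n; apply: IH; case: st le_st => [|x st] //= /andP[].
Qed.

(** A word that is feasible from [st1] alone never reaches the elements below. *)
Lemma stack_after_catl st1 st m w : feasible (size st1) w ->
  stack_after (st1 ++ st) m w = stack_after st1 m w ++ st.
Proof.
elim: w st1 m => [|[] w IH] st1 m //=.
  by move=> f_w; apply: (IH (_ :: _)).
by case: st1 => [|x st1] //= f_w; apply: IH.
Qed.

Lemma stack_after_balanced k st m w : balanced k w -> stack_after st m w = st.
Proof.
case/and3P=> f_w /eqP up /eqP dn; rewrite -[st in LHS]cat0s stack_after_catl //.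
have := @size_stack_after [::] m w f_w; rewrite up dn /= add0n subnn.
by move/size0nil->.
Qed.

(** * From permutations to words *)

Lemma output_nseq st m k w :
  output st m (nseq k true ++ w) = output (rev (iota m.+1 k) ++ st) (m + k) w.
Proof.
elim: k st m => [|k IH] st m /=; first by rewrite addn0.
by rewrite IH rev_cons cat_rcons addSnnS.
Qed.

Lemma gtn_trans : transitive gtn.
Proof. by move=> y x z /= xy yz; apply: ltn_trans yz xy. Qed.

Lemma sorted_push m k st : sorted gtn st -> all (geq m) st ->
  sorted gtn (rev (iota m.+1 k) ++ st).
Proof.
move=> so le_st; rewrite (sorted_pairwise gtn_trans) pairwise_cat.
rewrite -!(sorted_pairwise gtn_trans) so andbT rev_sorted.
rewrite (_ : sorted _ _ = sorted ltn (iota m.+1 k)) // iota_ltn_sorted andbT.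
apply/allrelP=> y z; rewrite mem_rev mem_iota => hy /(allP le_st) /=; lia.
Qed.

(** In a sequence without 312, the entries below the first one, [x], appear in
decreasing order.  So the entries at most [x] are listed in the order in which
they leave a stack that held the entries at most [m] and then received
m+1, ..., x.  *)
Lemma filter_push m x (s : seq nat) :
    uniq (x :: s) -> avoid (x :: s) -> m < x ->
    (forall y, m < y <= x -> y \in x :: s) ->
    sorted gtn (filter (geq m) s) ->
  filter (geq x) (x :: s) = rev (iota m.+1 (x - m)) ++ filter (geq m) s.
Proof.
move=> U /= /andP[av _] lt_mx fill so.
apply: (@irr_sorted_eq _ gtn gtn_trans); first by move=> y /=; rewrite ltnn.
- rewrite leqnn /= (path_sortedE gtn_trans); apply/andP; split.
    apply/allP=> y; rewrite mem_filter /= => /andP[le_yx ys].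
    rewrite ltn_neqAle le_yx andbT; apply: contraTneq U => <-.
    by rewrite /= ys.
  rewrite (sorted_pairwise gtn_trans).
  have: pairwise (fun y z => ~~ (y < z < x)) (filter (geq x) s).
    by apply: subseq_pairwise av; exact: filter_subseq.
  have us : uniq (filter (geq x) s) by apply: filter_uniq; case/andP: U.
  have lt : all (fun y => y < x) (filter (geq x) s).
    apply/allP=> y; rewrite mem_filter /= => /andP[le_yx ys].
    rewrite ltn_neqAle le_yx andbT; apply: contraTneq U => <-.
    by rewrite /= ys.
  elim: (filter _ _) us lt => //= y r IH /andP[yr ur] /andP[ly lr] /andP[pr par].
  rewrite IH // andbT; apply/allP=> z zr /=.
  have := allP pr z zr; have := allP lr z zr.
  have: z <> y by move=> e; rewrite -e zr in yr.
  lia.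
- by apply: sorted_push so _; exact: filter_all.
- move=> y; rewrite leqnn in_cons mem_cat mem_rev mem_iota !mem_filter /=.
  apply/idP/idP.
    by case/predU1P=> [->|/andP[le ->]]; lia.
  case/orP=> [h|/andP[le ->]]; last by lia.
  by have := fill y; rewrite in_cons => /(_ ltac:(lia)) /orP[->//|->]; lia.
Qed.

(** The stack is reconstructed from what remains to be printed: it consists of
the remaining entries at most [m], in their order in [s].  *)
Lemma output_code m (s : seq nat) :
    uniq s -> avoid s -> sorted gtn (filter (geq m) s) ->
    (forall x y, x \in s -> m < y <= x -> y \in s) ->
  [/\ output (filter (geq m) s) m (code m s) = s,
      feasible (size (filter (geq m) s)) (code m s),
      pops (code m s) = size s
    & size (filter (geq m) s) + pushes (code m s) = size s].
Proof.
elim: s m => [|x s IH] m; first by [].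
move=> U A so fill; have [le_xm|lt_mx] := leqP x m.
  have us : uniq s by case/andP: U.
  have as' : avoid s by case/andP: A.
  move: so; rewrite /= le_xm /= => so.
  have [||||E1 E2 E3 E4] := IH m => //.
    exact: path_sorted so.
    move=> z y zs h; have := fill z y; rewrite !in_cons zs orbT => /(_ isT h).
    by case/orP=> // /eqP e; move: h; rewrite e; lia.
  (* [x] is the top of the stack: it is popped without any push. *)
  rewrite (_ : x - m = 0) /=; last lia.
  rewrite (maxn_idPl le_xm) E1 E2 E3; split=> //; lia.
have so' : sorted gtn (filter (geq m) s).
  by move: so; rewrite /= leqNgt lt_mx.
have key := filter_push U A lt_mx (fun y => fill x y (mem_head _ _)) so'.
rewrite /= leqnn in key.
have us : uniq s by case/andP: U.
have as' : avoid s by case/andP: A.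
have sx : sorted gtn (x :: filter (geq x) s).
  rewrite key.
  by apply: sorted_push so' _; exact: filter_all.
have [||||E1 E2 E3 E4] := IH x => //.
  exact: path_sorted sx.
  move=> z y zs h; have := fill z y; rewrite !in_cons zs orbT.
  have -> : m < y <= z by lia.
  by move=> /(_ isT isT) /orP[] // /eqP e; move: h; rewrite e; lia.
have fm : filter (geq m) (x :: s) = filter (geq m) s by rewrite /= leqNgt lt_mx.
have szE : (size (filter (geq x) s)).+1 = size (filter (geq m) s) + (x - m).
  by move/(congr1 size): key; rewrite /= size_cat size_rev size_iota => ->; lia.
rewrite fm /= output_nseq feasible_nseq (maxn_idPr (ltnW lt_mx)) -key.
rewrite /= subnKC ?(ltnW lt_mx) // E1.
rewrite !count_cat !count_nseq /= E3.
split=> //; last by lia.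
by rewrite -szE /= E2.
Qed.

(** * From words to permutations *)

Lemma perm_output (st : seq nat) m w : pops w = size st + pushes w ->
    feasible (size st) w ->
  perm_eq (output st m w) (st ++ iota m.+1 (pushes w)).
Proof.
elim: w st m => [|[] w IH] st m /=.
- by rewrite addn0 cats0 => /esym/size0nil->.
- move=> e f_w; have := IH (m.+1 :: st) m.+1; rewrite /= => /(_ ltac:(lia) f_w).
  by move=> p; rewrite (permPl p) -cat1s perm_catCA.
case: st => [|x st] //= e f_w; rewrite perm_cons; apply: IH => //; lia.
Qed.

(** Later pushes go on top of the elements already in the stack, so they cannot
change the order in which these leave it.  *)
Lemma filter_output (st : seq nat) m w : pops w = size st + pushes w ->
    feasible (size st) w -> all (geq m) st ->
  filter (geq m) (output st m w) = st.
Proof.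
elim: w st m => [|[] w IH] st m /=.
- by rewrite addn0 => /esym/size0nil->.
- move=> e f_w le_st.
  have le_st' : all (geq m.+1) (m.+1 :: st).
    by rewrite /= leqnn; apply: sub_all le_st => x /= /leqW.
  have := IH (m.+1 :: st) m.+1 ltac:(rewrite /=; lia) f_w le_st'.
  move/(congr1 (filter (geq m))); rewrite -filter_predI /= ltnn.
  rewrite (all_filterP le_st) => {2}<-; apply: eq_filter => x /=; lia.
case: st => [|x st] //= e f_w /andP[-> le_st]; rewrite IH //; lia.
Qed.

(** When [x] is printed, the smaller values still to come are all in the stack,
under [x]; by [filter_output] they come out in decreasing order, so [x] cannot
be the 3 of a 312.  *)
Lemma avoid_output (st : seq nat) m w : pops w = size st + pushes w ->
    feasible (size st) w -> all (geq m) st -> sorted gtn st ->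
  avoid (output st m w).
Proof.
elim: w st m => [|[] w IH] st m //=.
- move=> e f_w le_st so; apply: (IH (m.+1 :: st)) => //=; first lia.
    by rewrite leqnn; apply: sub_all le_st => x /= /leqW.
  by rewrite (path_sortedE gtn_trans) so andbT.
case: st => [_ //|x st] /= e f_w /andP[le_xm le_st] so.
have e' : pops w = size st + pushes w by lia.
rewrite (IH st m) ?andbT //; last exact: path_sorted so.
have fo := filter_output e' f_w le_st.
have : pairwise (fun y z => y >= z) (filter (geq x) (output st m w)).
  have -> : filter (geq x) (output st m w)
         = filter (geq x) (filter (geq m) (output st m w)).
    by rewrite -filter_predI; apply: eq_filter => y /=; lia.
  rewrite fo; apply: subseq_pairwise (filter_subseq _ _) _.
  move: (path_sorted so); rewrite (sorted_pairwise gtn_trans).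
  by apply: sub_pairwise => y z /= /ltnW.
move: {fo} (output st m w) => r0.
elim: r0 => //= y r IHr; case: (leqP y x) => [le_yx|lt_xy].
  move=> /= /andP[ay pr]; rewrite IHr // andbT; apply/allP=> z zr.
  case: (leqP z x) => [le_zx|]; last lia.
  by have := allP ay z; rewrite mem_filter /= le_zx zr => /(_ isT); lia.
by move/IHr->; rewrite andbT; apply/allP=> z _; lia.
Qed.

(** The word can be read off its output: if it starts with a push, then m+1 leaves
the stack before all smaller elements, so the first entry printed exceeds [m].
*)
Lemma code_output (st : seq nat) m w : pops w = size st + pushes w ->
    feasible (size st) w -> all (geq m) st ->
  code m (output st m w) = w.
Proof.
elim: w st m => [|[] w IH] st m //=.
- move=> e f_w le_st.
  have le_st' : all (geq m.+1) (m.+1 :: st).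
    by rewrite /= leqnn; apply: sub_all le_st => x /= /leqW.
  have e' : pops w = size (m.+1 :: st) + pushes w by rewrite /=; lia.
  (* By [filter_output], the first entry is m+1 or larger. *)
  have := IH _ _ e' f_w le_st'; have := filter_output e' f_w le_st'.
  case: (output _ _ _) => //= x r.
  case: (leqP x m.+1) => [le_xm [-> _] <-|lt_mx _ <-].
    by rewrite subnn subSnn (maxn_idPr (leqnSn m)) ?maxnn.
  rewrite -[in RHS]cat1s catA -[[:: true]]/(nseq 1 true) -nseqD.
  rewrite (maxn_idPr _) 1?(maxn_idPr _); try lia.
  by congr (nseq _ _ ++ _); lia.
case: st => [|x st] //= e f_w /andP[le_xm le_st].
rewrite (_ : x - m = 0) /=; last lia.
by rewrite (maxn_idPl le_xm) IH //; lia.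
Qed.

(** * The bijection with permutations *)

Lemma avoidP (s : seq nat) :
  reflect (forall i j k, i < j -> j < k -> k < size s ->
             ~~ (nth 0 s j < nth 0 s k < nth 0 s i))
          (avoid s).
Proof.
elim: s => [|x s IH] /=; first by apply: ReflectT.
apply: (iffP andP) => [[/(pairwiseP 0) px /IH av] [|i] [|j] [|k] //= ij jk ks|av].
- by apply: px; rewrite ?inE //; lia.
- exact: av.
split; last by apply/IH => i j k ij jk ks; apply: (av i.+1 j.+1 k.+1).
apply/(pairwiseP 0) => j k /=; rewrite !inE => js ks jk.
exact: (av 0 j.+1 k.+1).
Qed.

Lemma size_one_line N (s : 'S_N) : size (one_line s) = N.
Proof. by rewrite size_map size_enum_ord. Qed.

Lemma nth_one_line N (s : 'S_N) (i : 'I_N) : nth 0 (one_line s) i = (s i).+1.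
Proof. by rewrite (nth_map i) ?size_enum_ord // nth_ord_enum. Qed.

Lemma avoids312E N (s : 'S_N) : avoids312 s = avoid (one_line s).
Proof.
apply/'forall_'forall_forallP/avoidP => [av i j k ij jk|av i j k].
  rewrite size_one_line => kN.
  have jN := ltn_trans jk kN; have iN := ltn_trans ij jN.
  have := av (Ordinal iN) (Ordinal jN) (Ordinal kN).
  rewrite -[i]/(val (Ordinal iN)) -[j]/(val (Ordinal jN)) -[k]/(val (Ordinal kN)).
  by rewrite !nth_one_line /= ij jk /= !ltnS andbC.
apply/negP=> /and4P[ij jk h1 h2].
have := av i j k ij jk; rewrite size_one_line !nth_one_line !ltnS h1 h2.
by move/(_ (ltn_ord k)).
Qed.

Lemma perm_one_line N (s : 'S_N) : perm_eq (one_line s) (iota 1 N).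
Proof.
have U : uniq (one_line s).
  by rewrite map_inj_uniq ?enum_uniq // => i j /= [] /val_inj /perm_inj.
apply: uniq_perm => //; first exact: iota_uniq.
have sub : {subset one_line s <= iota 1 N}.
  by move=> y /mapP[i _ ->]; rewrite mem_iota add1n !ltnS leq0n ltn_ord.
have := uniq_min_size U sub; rewrite size_one_line size_iota leqnn.
by case.
Qed.

Lemma one_line_inj N : injective (@one_line N).
Proof.
move=> s t e; apply/permP => i; apply/val_inj/succn_inj.
by rewrite -!nth_one_line e.
Qed.

Lemma one_line_surj N (l : seq nat) : perm_eq l (iota 1 N) ->
  exists s : 'S_N, one_line s = l.
Proof.
move=> p; have sz : size l = N by rewrite (perm_size p) size_iota.
have U : uniq l by rewrite (perm_uniq p) iota_uniq.
have in_l (i : 'I_N) : 0 < nth 0 l i <= N.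
  have : nth 0 l i \in l by rewrite mem_nth // sz.
  by rewrite (perm_mem p) mem_iota; lia.
have lt (i : 'I_N) : (nth 0 l i).-1 < N by have := in_l i; lia.
have inj : injective (fun i => Ordinal (lt i)).
  move=> i j /(congr1 val) /= e; apply/ord_inj/eqP.
  rewrite -(nth_uniq 0 _ _ U) ?sz //; have := in_l i; have := in_l j.
  move=> hj hi; have -> : nth 0 l i = nth 0 l j :> nat by lia.
  exact: eqxx.
exists (perm inj); apply: (@eq_from_nth _ 0); rewrite size_one_line ?sz //.
move=> i iN; rewrite -[i]/(val (Ordinal iN)) nth_one_line permE /=.
by have := in_l (Ordinal iN); rewrite /=; lia.
Qed.

Fixpoint words (n : nat) : seq (seq bool) :=
  if n is n'.+1 then map (cons true) (words n') ++ map (cons false) (words n')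
  else [:: [::]].

Lemma mem_words n w : (w \in words n) = (size w == n).
Proof.
elim: n w => [|n IH] [|b w] //=.
  by rewrite mem_cat; apply/negbTE/negP=> /orP[] /mapP[].
have inj c : injective (@cons bool c) by move=> u v [].
rewrite mem_cat eqSS -IH; case: b; rewrite mem_map //.
  by rewrite orbC; case: mapP => // -[].
by case: mapP => // -[].
Qed.

Lemma words_uniq n : uniq (words n).
Proof.
elim: n => //= n IH; have inj c : injective (@cons bool c) by move=> u v [].
rewrite cat_uniq !map_inj_uniq // IH /= andbT.
by apply/hasPn => w /mapP[u _ ->]; apply/mapP => -[].
Qed.

Lemma code_one_line N (s : 'S_N) : avoids312 s ->
  balanced N (code 0 (one_line s)) /\
  output [::] 0 (code 0 (one_line s)) = one_line s.
Proof.
rewrite avoids312E => av; have p := perm_one_line s.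
have U : uniq (one_line s) by rewrite (perm_uniq p) iota_uniq.
have f0 : filter (geq 0) (one_line s) = [::].
  apply/eqP; rewrite -[_ == _]negbK -has_filter; apply/hasPn => y.
  by rewrite (perm_mem p) mem_iota /=; lia.
have := @output_code 0 _ U av; rewrite f0 size_one_line /balanced add0n.
case=> // [x y|-> -> -> ->]; last by rewrite eqxx.
by rewrite !(perm_mem p) !mem_iota; lia.
Qed.

Lemma output_one_line N w : balanced N w ->
  exists2 s : 'S_N, avoids312 s & one_line s = output [::] 0 w.
Proof.
case/and3P=> f_w /eqP up /eqP dn.
have e : pops w = size (Nil nat) + pushes w by rewrite up dn.
have [|s sE] := @one_line_surj N (output [::] 0 w).
  by have := perm_output 0 e f_w; rewrite up.
by exists s; rewrite // avoids312E sE; apply: avoid_output.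
Qed.

(** The map [code] is the bijection between permutations avoiding 312 and Dyck
words, with inverse [output]; hence any statistic of the one-line notation can
be counted on words.  *)
Lemma card_avoids312 N (P : pred (seq nat)) :
  #|[set s : 'S_N | avoids312 s && P (one_line s)]| =
  count (fun w => balanced N w && P (output [::] 0 w)) (words (N + N)).
Proof.
rewrite cardE -size_filter -(size_map (fun s : 'S_N => code 0 (one_line s))).
apply/perm_size/uniq_perm; last first.
- move=> w; rewrite mem_filter mem_words; apply/mapP/idP => [[s]|].
    rewrite mem_enum inE => /andP[av Ps] ->; have [b ->] := code_one_line av.
    by rewrite b Ps /= -pushes_pops; case/and3P: b => _ /eqP-> /eqP->.
  case/andP=> /andP[b Pw] _; have [s av sE] := output_one_line b.
  exists s; first by rewrite mem_enum inE av sE.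
  case/and3P: b => f_w /eqP up /eqP dn.
  by rewrite sE code_output // up dn.
- exact/filter_uniq/words_uniq.
rewrite map_inj_in_uniq ?enum_uniq // => s t; rewrite !mem_enum !inE.
move=> /andP[/code_one_line[_ sE] _] /andP[/code_one_line[_ tE] _] e.
by apply: one_line_inj; rewrite -sE -tE e.
Qed.

(** * Matching a push with a pop *)

(** The word is w1 ++ true :: w2 ++ false :: w3 where w1 has [u] pushes and [d] pops
and w2 is a Dyck word of semilength [k]; thus the push number u+1 is undone by
the pop number d+k+1.  The lengths of w1 and w2 are known, so cutting with
[take] and [drop] makes this a boolean test; the default values of [head] make it
fail on words that are too short.  *)
Definition arch (u d k : nat) (w : seq bool) : bool :=
  let w' := drop (u + d) w in
  [&& pushes (take (u + d) w) == u, head false w',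
      balanced k (take (k + k) (behead w'))
    & ~~ head true (drop (k + k) (behead w'))].

Definition arch_tail (u d k : nat) (w : seq bool) : seq bool :=
  behead (drop (k + k) (behead (drop (u + d) w))).

Lemma arch_tail_cat u d k w1 w2 w3 : pushes w1 = u -> pops w1 = d ->
    balanced k w2 ->
  arch u d k (w1 ++ true :: w2 ++ false :: w3) /\
  arch_tail u d k (w1 ++ true :: w2 ++ false :: w3) = w3.
Proof.
move=> up dn b2; have /and3P[_ /eqP up2 /eqP dn2] := b2.
have s1 : size w1 = u + d by rewrite -pushes_pops up dn.
have s2 : size w2 = k + k by rewrite -pushes_pops up2 dn2.
rewrite /arch /arch_tail !(take_size_cat _ s1) !(drop_size_cat _ s1) /=.
by rewrite !(take_size_cat _ s2) !(drop_size_cat _ s2) /= up eqxx b2.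
Qed.

Lemma archE u d k w : arch u d k w ->
  exists w1 w2, [/\ w = w1 ++ true :: w2 ++ false :: arch_tail u d k w,
                    pushes w1 = u, pops w1 = d & balanced k w2].
Proof.
rewrite /arch /arch_tail.
have := cat_take_drop (u + d) w; have := size_take_min (u + d) w.
set w1 := take _ w; case E: (drop (u + d) w) => [|[] x] /=; rewrite ?andbF //.
have := cat_take_drop (k + k) x; set w2 := take _ x.
case: (drop (k + k) x) => [|[] y] /=; rewrite ?andbF // andbT.
move=> ex s1 ew /andP[/eqP up b2]; exists w1, w2; rewrite ex ew; split=> //.
have := congr1 size E; rewrite size_drop /= => sd.
by have := pushes_pops w1; rewrite s1; lia.
Qed.

Lemma arch_counts u d k w : arch u d k w ->
  pushes w = u + k + 1 + pushes (arch_tail u d k w) /\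
  pops w = d + k + 1 + pops (arch_tail u d k w).
Proof.
case/archE=> w1 [w2 [+ up1 dn1 b2]]; move: (arch_tail u d k w) => r ->.
case/and3P: b2 => _ /eqP up /eqP dn.
by rewrite !count_cat /= !count_cat /= up dn up1 dn1; split; lia.
Qed.

(** The value pushed at the start of the arch is printed at its end, and then the
machine continues from a stack all of whose elements are older than the arch.
*)
Lemma arch_output (st : seq nat) m u d k w : arch u d k w ->
    feasible (size st) w -> all (geq m) st ->
  exists st' o,
    [/\ size st' + d = size st + u, all (geq (m + u)) st',
        feasible (size st') (arch_tail u d k w), size o = d + k
      & output st m w =
        o ++ (m + u).+1 :: output st' (m + u + k).+1 (arch_tail u d k w)].
Proof.
move=> ar f_w le_st; have [w1 [w2 [ew up dn b2]]] := archE ar.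
move: ew; set r := arch_tail _ _ _ _ => ew; move: f_w.
rewrite ew feasible_cat => /andP[f1].
have s1 := size_stack_after m f1.
have le1 := feasible_pops f1.
rewrite -s1 => f2.
have := b2 => /and3P[fb /eqP up2 /eqP dn2].
exists (stack_after st m w1),
  (output st m w1 ++
   output [:: (m + u).+1 & stack_after st m w1] (m + u).+1 w2).
split.
- by rewrite s1 up dn; lia.
- by rewrite -up; apply: stack_after_leq.
- move: f2; rewrite /= feasible_cat => /andP[_ /=].
  by rewrite up2 dn2 addnK.
- by rewrite size_cat !size_output dn dn2.
rewrite output_cat /= output_cat /= up up2 (stack_after_balanced _ _ b2) /=.
by rewrite addSn catA.
Qed.

(** The push number u+1 has a single position in the word. *)
Lemma arch_unique u d k d' k' w : arch u d k w -> arch u d' k' w -> d = d'.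
Proof.
wlog lt_dd : d k d' k' / d < d' => [W a a'|].
  by case: (ltngtP d d') => // h; [exact: W a a'|apply/esym; exact: W a' a].
case/archE=> w1 [w2 [ew up dn _]]; move: ew; set r := arch_tail _ _ _ _ => ew.
case/andP; rewrite ew.
have -> : u + d' = size w1 + (d' - d) by rewrite -pushes_pops up dn; lia.
rewrite takeD take_size_cat // drop_size_cat // count_cat up.
by case: (d' - d) (subn_gt0 d d') => [|n _] /=; lia.
Qed.

(** The entry at position [p] is either pushed by the word itself, which gives an
arch, or it is the [q]-th element of the initial stack.  In the latter case the
prefix [w2] that precedes its pop is a path from height [q] to height 0; this
is kept in the induction because prepending the push of that element (case
q = 0) turns [w2] into the inside of an arch.  *)
Lemma letter_arch_or_stack (st : seq nat) m w p :
    feasible (size st) w -> p < pops w ->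
  (exists u d k, d + k = p /\ arch u d k w) \/
  (exists q w2 w3,
     [/\ q < size st, nth 0 (output st m w) p = nth 0 st q,
         w = w2 ++ false :: w3, feasible q w2
       & pops w2 = q + pushes w2 /\ pops w2 = p]).
Proof.
elim: w st m p => [|[] w IH] st m p //=.
- move=> f_w p_lt; have [|] := IH (m.+1 :: st) m.+1 p f_w ltac:(lia).
    by case=> u [d [k [dk ar]]]; left; exists u.+1, d, k.
  case=> -[|q] [w2 [w3 [lt_q -> ew f2 [e1 e2]]]].
    left; exists 0, 0, p; split=> //.
    have b2 : balanced p w2 by rewrite /balanced f2 -e2 e1 eqxx.
    by rewrite ew; exact: (@arch_tail_cat 0 0 p [::] w2 w3 erefl erefl b2).1.
  by right; exists q, (true :: w2), w3; split=> //=; [rewrite ew|lia].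
case: st => [|x st] //= f_w; case: p => [|p] p_lt.
  by right; exists 0, [::], w; split.
have [|] := IH st m p f_w ltac:(lia).
  case=> u [d [k [dk ar]]]; left; exists u, d.+1, k; split; first lia.
  by rewrite /arch addnS /= add0n.
case=> q [w2 [w3 [lt_q en ew f2 [e1 e2]]]].
by right; exists q.+1, (false :: w2), w3; split=> //=; [rewrite ew|lia].
Qed.

(** A value above [m] is not in the initial stack, so its pop closes an arch. *)
Lemma letter_arch (st : seq nat) m w p j : feasible (size st) w -> p < pops w ->
    all (geq m) st -> m < j -> nth 0 (output st m w) p = j ->
  exists2 d, d <= p & arch (j - m - 1) d (p - d) w.
Proof.
move=> f_w p_lt le_st lt_mj ej.
have [|] := letter_arch_or_stack m f_w p_lt.
  case=> u [d [k [dk ar]]]; exists d; first lia.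
  have [st' [o [_ _ _ so eo]]] := arch_output ar f_w le_st.
  move: ej; rewrite eo nth_cat so dk ltnn subnn /= => ej.
  have -> : j - m - 1 = u by lia.
  by have -> : p - d = k by lia.
case=> q [w2 [w3 [lt_q eq _ _ _]]].
by have := allP le_st _ (mem_nth 0 lt_q); rewrite -eq ej /=; lia.
Qed.

(** * Two prescribed letters *)

(** Pop number [a] undoes push number [j1] after i1 - 1 earlier pops, at which time
j1 + a - i1 pushes and [a] pops have been made; in the remaining word, the same
holds for [b], [j2] and [i2] once these numbers are subtracted.  *)
Definition two_arches (j1 j2 a b i1 i2 : nat) (w : seq bool) : bool :=
  arch (j1 - 1) (i1 - 1) (a - i1) w &&
  arch (j2 - (j1 + a - i1) - 1) (i2 - a - 1) (b - i2)
       (arch_tail (j1 - 1) (i1 - 1) (a - i1) w).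

(** The ranges of [i1] and [i2] are the exact conditions for the five pieces of the
path to have nonnegative heights and numbers of steps. *)
Lemma two_letters_arch N j1 j2 a b t w :
    0 < j1 -> j1 < a -> j1 < j2 -> a < b -> j2 < b -> b + t = N ->
    balanced N w ->
  (nth 0 (output [::] 0 w) a.-1 == j1) && (nth 0 (output [::] 0 w) b.-1 == j2)
  = has (fun i1 => has (fun i2 => two_arches j1 j2 a b i1 i2 w)
          (index_iota (maxn (a + 1) (j2 - t)) j2.+1))
      (index_iota (maxn 1 (j1 + (a + 1) - j2)) j1.+1).
Proof.
move=> j1_gt0 lt_j1a lt_j1j2 lt_ab lt_j2b btN /and3P[f_w /eqP upw /eqP dnw].
apply/andP/hasP => [[/eqP e1 /eqP e2]|[i1]].
  have [|||||d le_d ar1] := @letter_arch [::] 0 w a.-1 j1 => //; first lia.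
  have e_ar : arch (j1 - 1) (d.+1 - 1) (a - d.+1) w.
    have -> : j1 - 1 = j1 - 0 - 1 by lia.
    by have [-> ->] : d.+1 - 1 = d /\ a - d.+1 = a.-1 - d by lia.
  have [st' [o [sst le_st f_r so eo]]] :=
    @arch_output [::] 0 _ _ _ _ e_ar f_w isT.
  have [cu cd] := arch_counts e_ar.
  set r := arch_tail _ _ _ _ in f_r eo cu cd.
  have so' : size o = a.-1 by rewrite so; lia.
  have nb : nth 0 (output [::] 0 w) b.-1 =
            nth 0 (output st' (0 + (j1 - 1) + (a - d.+1)).+1 r) (b - a).-1.
    rewrite eo nth_cat so'; have -> : b.-1 < a.-1 = false by lia.
    by have -> : b.-1 - a.-1 = (b - a).-1.+1 by lia.
  have lt_pops : (b - a).-1 < pops r by lia.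
  have e_r : pops r = size st' + pushes r.
    by move: sst => /=; lia.
  set m := (0 + _ + _).+1 in nb eo.
  have mE : m = j1 + a - d.+1 by rewrite /m; lia.
  (* Otherwise [j2] would lie in the stack under [j1], hence be smaller. *)
  have lt_mj2 : m < j2.
    rewrite ltnNge; apply/negP => le_j2m.
    have : j2 \in output st' m r.
      by rewrite -e2 nb mem_nth // size_output.
    rewrite (perm_mem (perm_output m e_r f_r)) mem_cat mem_iota.
    case/orP=> [/(allP le_st) /=|]; lia.
  have le_st2 : all (geq m) st'.
    by apply: sub_all le_st => y /=; rewrite /m; lia.
  have := @letter_arch st' m r (b - a).-1 j2 f_r lt_pops le_st2 lt_mj2.
  rewrite -nb => /(_ e2) [d2 le_d2 ar2].
  have [st'' [o' [sst2 _ _ _ _]]] := arch_output ar2 f_r le_st2.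
  have [cu2 cd2] := arch_counts ar2.
  rewrite /= add0n in sst.
  exists d.+1.
    rewrite mem_index_iota geq_max.
    by clear -sst mE lt_mj2 le_d lt_j1a j1_gt0; lia.
  apply/hasP; exists (a + 1 + d2).
    rewrite mem_index_iota geq_max.
    by clear -sst sst2 mE lt_mj2 cu cu2 upw
      btN le_d le_d2 lt_ab lt_j1a j1_gt0; lia.
  rewrite /two_arches e_ar -mE -/r.
  have -> : a + 1 + d2 - a - 1 = d2 by rewrite -addnA addKn addKn.
  by have -> : b - (a + 1 + d2) = (b - a).-1 - d2 by rewrite !subnDA subn1.
rewrite mem_index_iota geq_max => h1 /hasP[i2].
rewrite mem_index_iota geq_max => h2 /andP[ar1 ar2].
have [st' [o [sst le_st f_r so eo]]] := @arch_output [::] 0 _ _ _ _ ar1 f_w isT.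
have so' : size o = a.-1 by rewrite so; lia.
set m := (0 + _ + _).+1 in eo.
have mE : m = j1 + a - i1 by rewrite /m; lia.
have le_st2 : all (geq m) st'.
  by apply: sub_all le_st => y /=; rewrite /m; lia.
have [st'' [o' [_ _ _ so2 eo2]]] := arch_output ar2 f_r le_st2.
split.
  by rewrite eo nth_cat so' ltnn subnn /=; apply/eqP; lia.
rewrite eo nth_cat so'; have -> : b.-1 < a.-1 = false by lia.
have -> : b.-1 - a.-1 = (b - a).-1.+1 by lia.
rewrite /= eo2 nth_cat so2.
have -> : i2 - a - 1 + (b - i2) = (b - a).-1 by lia.
by rewrite ltnn subnn /=; apply/eqP; lia.
Qed.

Lemma sum_nat_unique (I : eqType) (r : seq I) (P : pred I) : uniq r ->
    {in r &, forall i j, P i -> P j -> i = j} ->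
  \sum_(i <- r) P i = has P r.
Proof.
elim: r => [|x r IH] /=; first by rewrite big_nil.
case/andP=> xr ur inj; rewrite big_cons IH //; last first.
  by move=> i j ir jr; apply: inj; rewrite inE (ir, jr) orbT.
case Px: (P x) => //; case: hasP => // -[y yr Py]; case/negP: xr.
by rewrite (inj x y) // inE ?eqxx // yr orbT.
Qed.

Lemma two_letters_sum N j1 j2 a b t w :
    0 < j1 -> j1 < a -> j1 < j2 -> a < b -> j2 < b -> b + t = N ->
    balanced N w ->
  ((nth 0 (output [::] 0 w) a.-1 == j1)
     && (nth 0 (output [::] 0 w) b.-1 == j2) : nat)
  = \sum_(maxn 1 (j1 + (a + 1) - j2) <= i1 < j1.+1)
      \sum_(maxn (a + 1) (j2 - t) <= i2 < j2.+1) two_arches j1 j2 a b i1 i2 w.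
Proof.
move=> j1_gt0 lt_j1a lt_j1j2 lt_ab lt_j2b btN bal_w.
rewrite (two_letters_arch j1_gt0 lt_j1a lt_j1j2 lt_ab lt_j2b btN bal_w).
rewrite -sum_nat_unique ?iota_uniq //.
  apply: eq_big_seq => i1 _; rewrite sum_nat_unique ?iota_uniq // => i i'.
  rewrite !mem_index_iota !geq_max => hi hi' /andP[_ ar] /andP[_ ar'].
  by have := arch_unique ar ar'; lia.
move=> i i'; rewrite !mem_index_iota !geq_max => hi hi'.
case/hasP=> y _ /andP[ar _] /hasP[y' _ /andP[ar' _]].
by have := arch_unique ar ar'; lia.
Qed.

(** * Counting words *)

Lemma count_words_cat m n (P Q : pred (seq bool)) :
  count (fun w => P (take m w) && Q (drop m w)) (words (m + n)) =
  count P (words m) * count Q (words n).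
Proof.
elim: m P => [|m IH] P /=.
  rewrite (eq_count (a2 := fun w => P [::] && Q w)) => [|w]; last first.
    by rewrite take0 drop0.
  by case: (P [::]); rewrite ?mul1n ?mul0n ?count_pred0.
rewrite !count_cat !count_map mulnDl; congr (_ + _).
  exact: (IH (fun w => P (true :: w))).
exact: (IH (fun w => P (false :: w))).
Qed.

Lemma count_words_true n (Q : pred (seq bool)) :
  count (fun w => head false w && Q (behead w)) (words n.+1) =
  count Q (words n).
Proof. by rewrite /= count_cat !count_map /= count_pred0 addn0. Qed.

Lemma count_words_false n (Q : pred (seq bool)) :
  count (fun w => ~~ head true w && Q (behead w)) (words n.+1) =
  count Q (words n).
Proof. by rewrite /= count_cat !count_map /= count_pred0 add0n. Qed.

Definition nb_paths (h u d : nat) : nat :=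
  count (fun w => feasible h w && (pushes w == u)) (words (u + d)).

(** The pieces of an arch decomposition are independent, hence the product; the
inside of the arch is a Dyck word, so it is feasible from any height and leaves
the height unchanged.  *)
Lemma count_arch h u d k n (Q : pred (seq bool)) :
  count (fun w => [&& feasible h w, arch u d k w & Q (arch_tail u d k w)])
        (words (u + d + (k + k + n.+1).+1)) =
  nb_paths h u d * nb_paths 0 k k *
    count (fun w => feasible (h + u - d) w && Q w) (words n).
Proof.
pose F w := feasible (h + u - d) w && Q w.
have -> : nb_paths 0 k k = count (balanced k) (words (k + k)).
  apply: eq_in_count => w; rewrite mem_words /balanced -pushes_pops => /eqP e.
  by congr (_ && _); case: eqP => //= up; apply/esym/eqP; lia.
rewrite -mulnA -(count_words_false n F).
rewrite -(count_words_cat (k + k) n.+1 (balanced k)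
            (fun y => ~~ head true y && F (behead y))).
rewrite -(count_words_true _ (fun x => balanced k (take (k + k) x) &&
  (~~ head true (drop (k + k) x) && F (behead (drop (k + k) x))))).
rewrite -count_words_cat.
apply: eq_in_count => w; rewrite mem_words => /eqP sw.
rewrite /arch /arch_tail.
have := cat_take_drop (u + d) w; have := size_take_min (u + d) w.
set w1 := take _ w => s1 ew; rewrite -{1}ew feasible_cat.
case: eqP => [up|]; rewrite ?andbF //= andbT -!andbA; congr (_ && _).
have -> : pops w1 = d by move: (pushes_pops w1); rewrite s1; lia.
rewrite up; case: (drop (u + d) w) => [|[] x] /=; rewrite ?andbF //.
have := cat_take_drop (k + k) x; set w2 := take _ x => ex.
rewrite -{1}ex feasible_cat /=.
case f2: (feasible 0 w2); rewrite ?andbF //=.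
case: (pushes w2 =P k) => [up2|_]; rewrite ?andbF //=.
case: (pops w2 =P k) => [dn2|_]; rewrite ?andbF //=.
rewrite (_ : feasible _ w2) /=; last first.
  by have := feasible_addn (h + u - d).+1 f2; rewrite add0n.
rewrite up2 dn2 addnK; case: (drop (k + k) x) => [|[] y] /=; rewrite ?andbF //=.
Qed.

(** The reflection principle: paths that do go below 0 correspond, by reflecting
their start in the line of height -1, to all paths from height -h-2 to the same
end, which have [u + h + 1] up steps.  The induction removes the first step and
compares with Pascal's rule.  The bound on [d] says that the end height is at
least -1; at -1 the two binomial coefficients agree by symmetry.  *)
Lemma nb_pathsE h u d : d <= h + u + 1 ->
  nb_paths h u d + 'C(u + d, u + h + 1) = 'C(u + d, u).
Proof.
rewrite /nb_paths.
have [n] : {n | n = u + d} by exists (u + d).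
move=> /[dup] e <- le_d.
have {d e le_d} : n <= h + u + u + 1 by lia.
elim: n h u => [|n IH] h u le_n.
  by case: u le_n => [|u] _ /=; rewrite addn1.
rewrite /= count_cat !count_map /=.
have -> : count (preim (cons true) (fun w => feasible h w && (pushes w == u)))
                (words n) =
  if u is u'.+1
  then count (fun w => feasible h.+1 w && (pushes w == u')) (words n) else 0.
  case: u le_n => [|u] _.
    by rewrite (eq_count (a2 := pred0)) ?count_pred0 // => w; apply: andbF.
  by apply: eq_count => w; rewrite /= add1n eqSS.
have -> : count (preim (cons false) (fun w => feasible h w && (pushes w == u)))
                (words n) =
  if h is h'.+1
  then count (fun w => feasible h' w && (pushes w == u)) (words n) else 0.
  case: h le_n => [|h] _.
    by rewrite (eq_count (a2 := pred0)) ?count_pred0.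
  by apply: eq_count => w; rewrite /= add0n.
case: u le_n => [|u] le_n; case: h le_n => [|h] le_n.
- have -> : n = 0 by lia.
  by [].
- have := IH h 0 ltac:(lia).
  rewrite !add0n !addn1 !bin0 => <-.
  rewrite binS (@bin_small n h.+2) ?add0n ?addn0 //; lia.
- have := IH 1 u ltac:(lia); rewrite addn0.
  have -> : u.+1 + 0 + 1 = u.+2 by lia.
  have -> : u + 1 + 1 = u.+2 by lia.
  by rewrite !binS; lia.
have := IH h.+2 u ltac:(lia); have := IH h u.+1 ltac:(lia).
have -> : u.+1 + h.+1 + 1 = (u + h).+3 by lia.
have -> : u.+1 + h + 1 = (u + h).+2 by lia.
have -> : u + h.+2 + 1 = (u + h).+3 by lia.
by rewrite !binS; lia.
Qed.

Lemma count_two_arches N u1 d1 k1 u2 d2 k2 u3 d3 :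
    N = u1 + k1 + 1 + (u2 + k2 + 1 + u3) ->
    N = d1 + k1 + 1 + (d2 + k2 + 1 + d3) ->
  count (fun w => balanced N w &&
           (arch u1 d1 k1 w && arch u2 d2 k2 (arch_tail u1 d1 k1 w)))
        (words (N + N)) =
  nb_paths 0 u1 d1 * nb_paths 0 k1 k1 *
    (nb_paths (u1 - d1) u2 d2 * nb_paths 0 k2 k2 *
       nb_paths (u1 - d1 + u2 - d2) u3 d3).
Proof.
move=> Nu Nd.
pose Q2 w := pushes w == u3.
pose Q1 w := arch u2 d2 k2 w && Q2 (arch_tail u2 d2 k2 w).
transitivity (count (fun w =>
    [&& feasible 0 w, arch u1 d1 k1 w & Q1 (arch_tail u1 d1 k1 w)])
  (words (N + N))).
  apply: eq_in_count => w; rewrite mem_words -pushes_pops => /eqP sw.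
  rewrite /balanced -andbA; congr (_ && _).
  case a1: (arch u1 d1 k1 w); rewrite ?andbF //=; have [c1 _] := arch_counts a1.
  rewrite /Q1; case a2: (arch u2 _ _ _); rewrite ?andbF //= andbT.
  have [c2 _] := arch_counts a2; rewrite /Q2.
  by apply/andP/eqP => [[/eqP p1 _]|p1]; [|split; apply/eqP]; lia.
have -> : N + N = u1 + d1 + (k1 + k1 +
    (u2 + d2 + (k2 + k2 + (u3 + d3).+1).+1).+1).+1 by lia.
by rewrite count_arch add0n /Q1 count_arch.
Qed.

Lemma count_two_letters N j1 j2 a b t :
    0 < j1 -> j1 < a -> j1 < j2 -> a < b -> j2 < b -> b + t = N ->
  count (fun w => balanced N w &&
           ((nth 0 (output [::] 0 w) a.-1 == j1)
              && (nth 0 (output [::] 0 w) b.-1 == j2))) (words (N + N)) =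
  \sum_(maxn 1 (j1 + (a + 1) - j2) <= i1 < j1.+1)
    \sum_(maxn (a + 1) (j2 - t) <= i2 < j2.+1)
      nb_paths 0 (j1 - 1) (i1 - 1) * nb_paths 0 (a - i1) (a - i1) *
      (nb_paths (j1 - i1) (j2 - (j1 + a - i1) - 1) (i2 - a - 1) *
       nb_paths 0 (b - i2) (b - i2) *
       nb_paths (j2 - i2) (i2 + t - j2) t).
Proof.
move=> j1_gt0 lt_j1a lt_j1j2 lt_ab lt_j2b btN.
have sum_count (P : pred (seq bool)) r : count P r = \sum_(w <- r) P w.
  by rewrite -sum1_count big_mkcond; apply: eq_bigr => w _; case: (P w).
rewrite sum_count.
transitivity (\sum_(w <- words (N + N))
    \sum_(maxn 1 (j1 + (a + 1) - j2) <= i1 < j1.+1)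
      \sum_(maxn (a + 1) (j2 - t) <= i2 < j2.+1) 
        (balanced N w && two_arches j1 j2 a b i1 i2 w)).
  apply: eq_bigr => w _; case bal: (balanced N w) => /=.
    exact: (two_letters_sum j1_gt0 lt_j1a lt_j1j2 lt_ab lt_j2b btN bal).
  by rewrite big1 // => i1 _; rewrite big1.
rewrite exchange_big; apply: eq_big_nat => i1; rewrite geq_max => h1.
rewrite exchange_big; apply: eq_big_nat => i2; rewrite geq_max => h2.
rewrite -sum_count (@count_two_arches N _ _ _ _ _ _ (i2 + t - j2) t); try lia.
congr (_ * (nb_paths _ _ _ * _ * nb_paths _ _ _));
  by clear -h1 h2 btN lt_j1a lt_ab lt_j2b; lia.
Qed.

(** * Closed forms *)

(** The ballot numbers: paths starting at height 0. *)
Lemma nb_paths_above u d : d <= u ->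
  u.+1 * nb_paths 0 u d = (u - d + 1) * 'C(u + d, u).
Proof.
move=> le_du; have := @nb_pathsE 0 u d ltac:(lia).
have := mul_bin_left (u + d) u; rewrite addn0 addn1 addKn.
move: (nb_paths 0 u d) 'C(u + d, u.+1) 'C(u + d, u) => x y z e1 e2.
have -> : u - d + 1 = u.+1 - d by lia.
by rewrite mulnBl -e1 -e2 mulnDr addnK.
Qed.

(** The mirror image of the ballot numbers: paths ending at height 0. *)
Lemma nb_paths_return h u d : h + u = d ->
  d.+1 * nb_paths h u d = h.+1 * 'C(u + d, d).
Proof.
move=> e; have := @nb_pathsE h u d ltac:(lia).
have := mul_bin_left (u + d) d; rewrite addnK.
have -> : u + h + 1 = d.+1 by lia.
have -> : 'C(u + d, u) = 'C(u + d, d) by rewrite -bin_sub ?leq_addr // addKn.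
move: (nb_paths h u d) 'C(u + d, d.+1) 'C(u + d, d) => x y z e1 e2; nia.
Qed.

Local Open Scope ring_scope.

Lemma nb_paths_aboveQ u d : (d <= u)%N ->
  (nb_paths 0 u d)%:R = (u - d + 1)%N%:R / u.+1%:R * 'C(u + d, u)%:R :> rat.
Proof.
move=> /nb_paths_above/(congr1 (fun n => n%:R : rat)); rewrite !natrM => e.
have u0 : u.+1%:R != 0 :> rat by rewrite pnatr_eq0.
by rewrite mulrAC -e mulrC mulKf.
Qed.

Lemma nb_paths_returnQ h u d : (h + u = d)%N ->
  (nb_paths h u d)%:R = h.+1%:R / d.+1%:R * 'C(u + d, d)%:R :> rat.
Proof.
move=> /nb_paths_return/(congr1 (fun n => n%:R : rat)); rewrite !natrM => e.
have d0 : d.+1%:R != 0 :> rat by rewrite pnatr_eq0.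
by rewrite mulrAC -e mulrC mulKf.
Qed.

Lemma nb_paths_catalan k : (nb_paths 0 k k)%:R = catalan k.
Proof.
by rewrite nb_paths_aboveQ // subnn /catalan mul2n addnn mul1r mulrC.
Qed.

Lemma binzE (x y : int) n m : x = n%:Z -> y = m%:Z -> binz x y = 'C(n, m)%:R.
Proof.
move=> -> ->; rewrite /binz lez_nat /=.
by case: (leqP m n) => // lt_nm; rewrite bin_small.
Qed.

Lemma nb_paths_binz h u d (x y z : int) : (d <= h + u + 1)%N ->
    x = (u + d)%N%:Z -> y = u%:Z -> z = (u + h + 1)%N%:Z ->
  (nb_paths h u d)%:R = binz x y - binz x z.
Proof.
move=> le_d ex ey ez; rewrite (binzE ex ey) (binzE ex ez).
by rewrite -(nb_pathsE le_d) natrD addrK.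
Qed.

(** * The enumeration *)

Unset Implicit Arguments.

(* The natural subtractions N - t and N - t - i never truncate under the
   hypotheses.  In the lower summation bounds, truncation at 0 is harmless
   because of the maximum with a positive number.  *)
Theorem theorem2p10 (N j1 j2 t1 t2 : nat)
    (hN : (0 < N)%N) (hj1 : (0 < j1)%N) (hj2 : (0 < j2)%N)
    (ht1 : (0 < t1)%N) (ht2 : (0 < t2)%N)
    (hjt : (j1 < N - t1)%N) (htt : (N - t1 < N - t2)%N)
    (hjj : (j1 < j2)%N) (hj2t : (j2 < N - t2)%N) :
  ((j2 < N - t1 + 1)%N -> #|Sne N j1 j2 t1 t2| = 0%N) /\
  ((N - t1 + 1 <= j2)%N ->
   #|Sne N j1 j2 t1 t2|%:R =
   \sum_(maxn 1 (j1 + (N - t1 + 1) - j2) <= i1 < j1.+1)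
   \sum_(maxn (N - t1 + 1) (j2 - t2) <= i2 < j2.+1)
     catalan (N - t1 - i1) * catalan (N - t2 - i2)
     * (((j1 - i1 + 1)%N%:R * (j2 - i2 + 1)%N%:R)
        / (j1%:R * (t2 + 1)%N%:R))
     * 'C(j1 + i1 - 2, j1 - 1)%:R * 'C(i2 + 2 * t2 - j2, t2)%:R
     * (binz (i1%:Z + i2%:Z + j2%:Z - j1%:Z - 2 * (N%:Z - t1%:Z + 1))
             (j2%:Z + (i1%:Z - j1%:Z - 1) - (N%:Z - t1%:Z))
        - binz (i1%:Z + i2%:Z + j2%:Z - j1%:Z - 2 * (N%:Z - t1%:Z + 1))
               (j2%:Z - (N%:Z - t1%:Z)))).
Proof.
pose a := (N - t1)%N; pose b := (N - t2)%N.
have cardE : #|Sne N j1 j2 t1 t2| = _ :=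
  etrans (card_avoids312 _ (fun l => (nth 0%N l a.-1 == j1)
                                     && (nth 0%N l b.-1 == j2)))
    (count_two_letters hj1 hjt hjj htt hj2t (@subnK t2 N ltac:(lia))).
split=> hj.
  (* The range of [i1] is empty. *)
  by rewrite cardE big_geq //; lia.
rewrite cardE natr_sum; apply: eq_big_nat => i1; rewrite geq_max => h1.
rewrite natr_sum; apply: eq_big_nat => i2; rewrite geq_max => h2.
rewrite !natrM !nb_paths_catalan nb_paths_aboveQ; last lia.
rewrite (@nb_paths_returnQ (j2 - i2)); last lia.
rewrite -(@nb_paths_binz (j1 - i1) (j2 - (j1 + (N - t1) - i1) - 1)
            (i2 - (N - t1) - 1)); try lia.
have -> : (j1 - 1 - (i1 - 1) + 1 = j1 - i1 + 1)%N by lia.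
have -> : ((j1 - 1).+1 = j1)%N by lia.
have -> : (j1 - 1 + (i1 - 1) = j1 + i1 - 2)%N by lia.
have -> : (i2 + t2 - j2 + t2 = i2 + 2 * t2 - j2)%N by lia.
rewrite -(addn1 (j2 - i2)) -(addn1 t2) invfM.
move: (catalan _) (catalan _) (nb_paths _ _ _)%:R => c1 c2 m.
move: (j1 - i1 + 1)%:R (j2 - i2 + 1)%:R j1%:R^-1 (t2 + 1)%:R^-1 => p q x y.
move: 'C(_, _)%:R 'C(_, _)%:R => r s; ring.
Qed.
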